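(* Let $c\ge 0$ be a fixed real number. Then $$\lim_{n\to\infty}\exp(-c\sqrt{n})\left(1+\frac{c}{\sqrt{n}}\right)^n=\exp\left(-\tfrac12c^2\right),$$ where $n$ runs through the positive integers. *)

(* Defs.v *)
From Stdlib Require Export Reals.
From Coquelicot Require Export Coquelicot.

(* Main.v *)
Require Import Defs.
From Stdlib Require Import Reals Lra.
From Coquelicot Require Import Coquelicot.
Open Scope R_scope.

(** With [x = c / sqrt n] the logarithm of the general term is
    [n * (ln (1 + x) - x)], and [x - x^2/2 <= ln (1 + x) <= x - x^2/2 + x^3/3]
    squeezes it between [- c^2/2] and [- c^2/2 + c^3 / (3 sqrt n)]. *)

(** By the mean value theorem, [f x - f 0] is [x] times a value of [f'] on [[0, x]]. Both logarithm
    bounds below thus reduce to the sign of a derivative. *)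
Lemma nonneg_of_derive_nonneg (f f' : R -> R) (x : R) :
  0 <= x -> f 0 = 0 ->
  (forall t, 0 <= t -> is_derive f t (f' t)) ->
  (forall t, 0 <= t -> 0 <= f' t) ->
  0 <= f x.
Proof.
intros [hx | <-] f0 hf hpos; [ | lra].
destruct (MVT_cor2 f f' 0 x hx) as [t [ht1 ht2]].
  now intros t ht; apply is_derive_Reals, hf.
assert (0 <= f' t * (x - 0)) by (apply Rmult_le_pos; [apply hpos | ]; lra).
lra.
Qed.

(** The difference of the two sides has derivative [1 / (1 + t) - 1 + t = t ^ 2 / (1 + t)]. *)
Lemma ln_1p_lower (x : R) : 0 <= x -> x - x ^ 2 / 2 <= ln (1 + x).
Proof.
intros hx.
enough (0 <= ln (1 + x) - (x - x ^ 2 / 2)) by lra.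
apply (nonneg_of_derive_nonneg (fun t => ln (1 + t) - (t - t ^ 2 / 2))
         (fun t => t ^ 2 / (1 + t))); trivial.
- rewrite Rplus_0_r, ln_1; field.
- intros t ht; auto_derive; [lra | field; lra].
- intros t ht; apply Rdiv_le_0_compat; [apply pow_le | ]; lra.
Qed.

(** Here the derivative is [1 - t + t ^ 2 - 1 / (1 + t) = t ^ 3 / (1 + t)]. *)
Lemma ln_1p_upper (x : R) : 0 <= x -> ln (1 + x) <= x - x ^ 2 / 2 + x ^ 3 / 3.
Proof.
intros hx.
enough (0 <= x - x ^ 2 / 2 + x ^ 3 / 3 - ln (1 + x)) by lra.
apply (nonneg_of_derive_nonneg
         (fun t => t - t ^ 2 / 2 + t ^ 3 / 3 - ln (1 + t))
         (fun t => t ^ 3 / (1 + t))); trivial.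
- rewrite Rplus_0_r, ln_1; field.
- intros t ht; auto_derive; [lra | field; lra].
- intros t ht; apply Rdiv_le_0_compat; [apply pow_le | ]; lra.
Qed.

Lemma is_lim_seq_div_sqrt_S (a : R) :
  is_lim_seq (fun k : nat => a / sqrt (INR (S k))) 0.
Proof.
(* In [Rbar] the inverse of [p_infty] is 0, so the limit takes the shape given by the scaling and
   inverse rules. *)
replace (Finite 0) with (Rbar_mult a (Rbar_inv p_infty))
  by (simpl; f_equal; ring).
apply is_lim_seq_scal_l.
apply is_lim_seq_inv; [ | discriminate].
apply (is_lim_seq_incr_1 (fun n => sqrt (INR n))).
apply (filterlim_comp _ _ _ INR sqrt _ _ _ is_lim_seq_INR filterlim_sqrt_p).
Qed.

Theorem mainTheorem5 (c : R) (hc : 0 <= c) :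
  is_lim_seq
    (fun k : nat =>
       exp (- c * sqrt (INR (S k))) * (1 + c / sqrt (INR (S k))) ^ (S k))
    (Finite (exp (- (1 / 2) * c ^ 2))).
Proof.
assert (hs : forall k, 0 < sqrt (INR (S k)))
  by (intros k; apply sqrt_lt_R0, lt_0_INR, Nat.lt_0_succ).
assert (hx : forall k, 0 <= c / sqrt (INR (S k)))
  by (intros k; apply Rdiv_le_0_compat; auto).
(* As [1 + c / sqrt n] is positive, its [n]-th power is [exp (n * ln (1 + c / sqrt n))]; continuity
   of [exp] then leaves only the limit of the exponent. *)
apply is_lim_seq_ext with (fun k => exp (- c * sqrt (INR (S k))
    + INR (S k) * ln (1 + c / sqrt (INR (S k))))).
  intros k; rewrite exp_plus; f_equal.
  specialize (hx k).
  rewrite <- Rpower_pow by lra; reflexivity.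
apply is_lim_seq_continuous.
  apply derivable_continuous_pt, derivable_pt_exp.
apply is_lim_seq_le_le with (fun _ => - (1 / 2) * c ^ 2)
  (fun k => - (1 / 2) * c ^ 2 + c ^ 3 / 3 / sqrt (INR (S k))).
- intros k; specialize (hx k); specialize (hs k).
  assert (hl := ln_1p_lower _ hx); assert (hu := ln_1p_upper _ hx).
  assert (hn : INR (S k) = sqrt (INR (S k)) ^ 2)
    by (rewrite pow2_sqrt; [reflexivity | apply pos_INR]).
  (* With [s] for the square root, [n] becomes [s ^ 2] and only algebra in [c], [s], [l] remains. *)
  revert hn hl hu; generalize (ln (1 + c / sqrt (INR (S k)))); intros l.
  revert hs; generalize (sqrt (INR (S k))); intros s hs -> hl hu.
  (* Scaled by [s ^ 2], both bounds acquire the leading term [c * s], which cancels the [- c * s] of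
     the exponent. *)
  apply (Rmult_le_compat_l (s ^ 2)) in hl; [ | apply pow2_ge_0].
  apply (Rmult_le_compat_l (s ^ 2)) in hu; [ | apply pow2_ge_0].
  replace (s ^ 2 * (c / s - (c / s) ^ 2 / 2)) with (c * s - c ^ 2 / 2)
    in hl by (field; lra).
  replace (s ^ 2 * (c / s - (c / s) ^ 2 / 2 + (c / s) ^ 3 / 3))
    with (c * s - c ^ 2 / 2 + c ^ 3 / 3 / s) in hu by (field; lra).
  lra.
- apply is_lim_seq_const.
- replace (Finite (- (1 / 2) * c ^ 2))
    with (Finite (- (1 / 2) * c ^ 2 + 0)) by (f_equal; ring).
  apply is_lim_seq_plus'; [apply is_lim_seq_const | apply is_lim_seq_div_sqrt_S].
Qed.
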